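(* Let $n\ge 1$ and $I \subseteq [n-1]$. Then (a) $\alpha_n(I) = \sum_{d\mid (I,n)} \frac{n}{d}\, \alpha^{\mathrm{cyc}}_{n/d}(I/d)$; (b) $\alpha^{\mathrm{cyc}}_n(I) = \frac{1}{n}\sum_{d\mid (I,n)} \mathrm{M\ddot{o}b}(d)\,\alpha_{n/d}(I/d)$; (c) $\beta^{\mathrm{cyc}}_n(I) = \frac{1}{n} \sum_{d\mid n} \mathrm{M\ddot{o}b}(d)\,(-1)^{|I|-|I/d|}\,\beta_{n/d}(I/d)$; (d) $\beta_n(I) = \sum_{d\mid n} (-1)^{|I|-|I/d|}\,\frac{n}{d}\,\beta^{\mathrm{cyc}}_{n/d}(I/d)$.
   Context: $[n]=\{1,\dots,n\}$ (so $[0]=\varnothing$). $S_n$ is the symmetric group on $[n]$ and $C_n\subseteq S_n$ is the set of permutations consisting of a single cycle of length $n$. The descent set of $\pi\in S_n$ is $D(\pi)=\{i\in[n-1] : \pi(i)>\pi(i+1)\}$. For $I\subseteq[n-1]$: $\alpha_n(I)=\#\{\pi\in S_n: D(\pi)\subseteq I\}$, $\alpha^{\mathrm{cyc}}_n(I)=\#\{\pi\in C_n: D(\pi)\subseteq I\}$, $\beta_n(I)=\#\{\pi\in S_n: D(\pi)= I\}$, $\beta^{\mathrm{cyc}}_n(I)=\#\{\pi\in C_n: D(\pi)=I\}$. $(I,n)=\gcd(I\cup\{n\})$, and for an integer $d\ge1$, $I/d=\{i/d : i\in I,\ d\mid i\}$. $\mathrm{M\ddot{o}b}$ is the number-theoretic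 Möbius function. Sums over $d$ range over positive divisors. *)

(* Defs.v *)
From HB Require Import structures.
From mathcomp Require Import all_boot all_order all_algebra all_fingroup.
From mathcomp Require Import finmap.

Set Implicit Arguments.
Unset Strict Implicit.
Unset Printing Implicit Defensive.

Local Open Scope fset_scope.
Local Open Scope nat_scope.

(* ['S_n] permutes 'I_n = {0, .., n-1}; shifting positions and values by one   *)
(* identifies it with the symmetric group on {1, .., n}. The 1-based positions *)
(* i and i+1 are the ordinals of values i-1 and i, so the 1-based descent i is *)
(* recorded below as the value of the second of the two adjacent positions.    *)
Definition descents (n : nat) (s : 'S_n) : {fset nat} :=
  [fset val j | j in 'I_n & [exists i : 'I_n, (i.+1 == j) && (s j < s i)]].

Definition single_cycle (n : nat) : {set 'S_n} :=
  [set s : 'S_n | porbits s == [set [set: 'I_n]]].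

Definition alpha (n : nat) (I : {fset nat}) : nat :=
  #|[set s : 'S_n | descents s `<=` I]|.

Definition alpha_cyc (n : nat) (I : {fset nat}) : nat :=
  #|[set s in single_cycle n | descents s `<=` I]|.

Definition beta (n : nat) (I : {fset nat}) : nat :=
  #|[set s : 'S_n | descents s == I]|.

Definition beta_cyc (n : nat) (I : {fset nat}) : nat :=
  #|[set s in single_cycle n | descents s == I]|.

Definition gcd_with (I : {fset nat}) (n : nat) : nat :=
  \big[gcdn/0]_(i <- n |` I) i.

Definition fset_div (I : {fset nat}) (d : nat) : {fset nat} :=
  [fset i %/ d | i in I & d %| i].

(* [primes n] lists the prime divisors of n without repetition; only n > 0 is   *)
(* meaningful.                                                                  *)
Definition moebius (n : nat) : int :=
  if all (fun p => logn p n == 1) (primes n) then ((-1) ^+ size (primes n))%R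
  else 0%R.

(* Main.v *)
Require Import Defs.
From HB Require Import structures.
From mathcomp Require Import all_boot all_order all_algebra all_fingroup.
From mathcomp Require Import finmap zify.

Set Implicit Arguments.
Unset Strict Implicit.
Unset Printing Implicit Defensive.

Import Order.TTheory GRing.Theory Num.Theory.

(** The set I cuts the n positions into consecutive blocks, and the descents of
    a permutation lie in I exactly when it increases on every block
    ([descents_subP]). Consider the rearrangements of the word that spells, for
    each position in turn, the number of its block ([words n I]); two bijections
    turn the counts of permutations into counts of words.

    - A permutation s with descents in I is determined by the word b o s^-1,
      where b y is the block of y: s^-1 ranks the positions of the word by
      their letters, equal letters from left to right. Hence
      [alpha n I = size (words n I)] ([alpha_words]).

    - If s is moreover an n-cycle, then a starting point x has the itinerary
      b x, b (s x), b (s (s x)), ..., which is a word of the same content. As s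
      increases on blocks, the points s^j x are ordered like the rotations of
      the itinerary, compared lexicographically. So the itinerary is primitive
      (no proper rotation fixes it), it determines s and x, and every primitive
      word arises: label its rotations by their lexicographic ranks and let s be
      the rotation by one letter. Hence n * [alpha_cyc n I] is the number of
      primitive words ([alpha_cyc_words]).

    Every word is, in a unique way, the d-th power of a primitive word. A d-th
    power can be a rearrangement of the word of I only if d divides n and all
    elements of I, and then the root ranges over the words of length n / d
    attached to I / d ([size_words_primitive]). This is the formula for [alpha];
    Moebius inversion over the divisors of the gcd yields the one for
    [alpha_cyc].

    The numbers [beta] are alternating sums of the numbers [alpha] over the
    subsets of I. In the alternating sum of a function of J that vanishes unless
    d divides all of J, and otherwise depends only on J / d, each element of I
    that d does not divide contributes a factor -1, so that the sum collapses to
    an alternating sum over the subsets of I / d ([altsum_div]). Applied to each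
    term of the two formulas for [alpha], this gives the two for [beta]. *)

Local Open Scope fset_scope.
Local Open Scope nat_scope.

(** * Blocks of positions *)

Definition block (I : {fset nat}) (y : nat) : nat :=
  count (fun i => i <= y) (enum_fset I).

Lemma block_mono I y z : y <= z -> block I y <= block I z.
Proof. by move=> yz; apply: sub_count => i /= /leq_trans; apply. Qed.

Lemma block_eqP I y z : y <= z ->
  reflect (forall i, i \in I -> ~~ (y < i <= z)) (block I y == block I z).
Proof.
move=> yz; rewrite /block.
have -> : count (fun i => i <= z) (enum_fset I) =
    count (fun i => i <= y) (enum_fset I) +
    count (fun i => y < i <= z) (enum_fset I).
  rewrite -count_predUI [X in _ = _ + X](_ : _ = 0) ?addn0.
    by apply: eq_count => i /=; lia.
  by apply/eqP; rewrite -leqn0 leqNgt -has_count; apply/hasP => -[i _ /=]; lia.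
rewrite -[X in X == _]addn0 eqn_add2l eq_sym -leqn0 leqNgt -has_count.
apply: (iffP idP) => [/hasPn h i iI | h].
  by apply: h.
by apply/hasPn => i iI; apply: h.
Qed.

Lemma block_lt_mem I y i : i \in I -> (block I y < block I i) = (y < i).
Proof.
move=> iI; case: (ltnP y i) => yi; last first.
  by apply/negbTE; rewrite -leqNgt block_mono.
rewrite ltn_neqAle block_mono ?(ltnW yi) // andbT.
by apply/block_eqP => [|/(_ i iI)]; rewrite ?yi ?leqnn // ltnW.
Qed.

Lemma block_lt_imp I y z : block I y < block I z -> y < z.
Proof. by apply: contraTT; rewrite -!leqNgt; apply: block_mono. Qed.

(** Two positions share a block when no element of I separates them, so that each
    step from one to the other is an ascent. *)
Lemma descents_subP n (s : 'S_n) I :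
  reflect (forall y z : 'I_n, y < z -> block I y = block I z -> s y < s z)
          (descents s `<=` I).
Proof.
apply: (iffP idP) => [/fsubsetP sub y z | incr].
  have [k] := ubnP (z - y); elim: k y z => // k IHk y z lek yz byz.
  have lty1 : y.+1 < n by apply: leq_ltn_trans yz (ltn_ord z).
  pose u := Ordinal lty1.
  have syu : s y < s u.
    rewrite ltnNge leq_eqVlt.
    apply/negP => /orP[/eqP/val_inj/perm_inj/(congr1 val)/=|lt]; first by lia.
    have uI : y.+1 \in I.
      apply: sub; apply/imfsetP; exists u => //=.
      by rewrite inE; apply/existsP; exists y; rewrite eqxx.
    by have := block_eqP I (ltnW yz); rewrite byz eqxx => /elimT/(_ isT _ uI); lia.
  have [uz|zu] := ltnP u z; last first.
    by have -> : z = u by apply: val_inj => /=; move: zu yz => /=; lia.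
  apply: ltn_trans syu (IHk _ _ _ uz _) => [/=|]; first by lia.
  apply/eqP; rewrite eqn_leq block_mono ?(ltnW uz) //= -byz.
  exact: block_mono.
apply/fsubsetP => _ /imfsetP[u /= + ->]; rewrite inE => /existsP[y /andP[/eqP yu lt]].
apply: contraTT lt => uI; rewrite -leqNgt ltnW // incr -?yu //.
apply/eqP/block_eqP => // i iI; apply: contraNN uI => ?.
by have <- : i = u by lia.
Qed.

(** * Permutations as rankings *)

Lemma card_ord_lt n m : m <= n -> #|[set y : 'I_n | y < m]| = m.
Proof.
move=> mn; have winj : injective (widen_ord mn).
  by move=> a b /(congr1 val)/= /val_inj.
rewrite -[RHS]card_ord -(card_imset _ winj).
apply: eq_card => y; rewrite inE; apply/idP/imsetP => [ym | [z _ ->] //=].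
by exists (Ordinal ym) => //; apply: val_inj.
Qed.

Lemma card_below n (r : 'S_n) j : #|[set k | r k < r j]| = r j.
Proof.
rewrite -[RHS](card_ord_lt (ltnW (ltn_ord (r j)))).
rewrite -[RHS](card_preimset _ (@perm_inj _ r)).
by apply: eq_card => k; rewrite !inE.
Qed.

(** The value at j is the number of points that the permutation ranks below j. *)
Lemma perm_order_inj n (r r' : 'S_n) :
  (forall j k, (r j < r k) = (r' j < r' k)) -> r = r'.
Proof.
move=> eqlt; apply/permP => j; apply: val_inj.
by rewrite /= -card_below -[RHS]card_below; apply: eq_card => k; rewrite !inE.
Qed.

(** Both bijections between words and permutations build the permutation from a
    word in this way, with different keys. *)
Lemma rank_perm n (key : 'I_n -> nat) : injective key ->
  exists r : 'S_n, forall j k, (r j < r k) = (key j < key k).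
Proof.
move=> key_inj; pose A j := [set k | key k < key j].
have rk j : #|A j| < n.
  rewrite -[X in _ < X]card_ord -cardsT; apply: proper_card; apply/properP; split=> //.
  by exists j => //; rewrite inE ltnn.
have mono j k : key j < key k -> #|A j| < #|A k|.
  move=> jk; apply: proper_card; apply/properP; split.
    by apply/subsetP => l; rewrite !inE => /ltn_trans; apply.
  by exists j; rewrite !inE ?ltnn.
have rinj : injective (fun j => Ordinal (rk j)).
  move=> j k /(congr1 val)/= eqjk; apply: key_inj.
  by case: (ltngtP (key j) (key k)) => // /mono; rewrite eqjk ltnn.
exists (perm rinj) => j k; rewrite !permE /=.
apply/idP/idP => [|/mono //]; apply: contraTT; rewrite -!leqNgt leq_eqVlt.
by case/orP=> [/eqP/key_inj -> // | /mono/ltnW].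
Qed.

(** * Words with prescribed content *)

Definition std_word n I := [seq block I y | y <- iota 0 n].

Definition words n I := permutations (std_word n I).

Lemma size_std_word n I : size (std_word n I) = n.
Proof. by rewrite size_map size_iota. Qed.

Lemma size_words n I w : w \in words n I -> size w = n.
Proof. by rewrite mem_permutations => /perm_size ->; rewrite size_std_word. Qed.

Lemma words_uniq n I : uniq (words n I).
Proof. exact: permutations_uniq. Qed.

Lemma enum_words n I (f : 'I_n -> 'I_n) : injective f ->
  [seq block I (f j) | j <- enum 'I_n] \in words n I.
Proof.
move=> finj; rewrite mem_permutations /std_word -val_enum_ord -map_comp.
rewrite (map_comp (fun y : 'I_n => block I y) f); apply: perm_map.
apply: uniq_perm; rewrite ?enum_uniq ?(map_inj_uniq finj) ?enum_uniq // => y.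
rewrite mem_enum inE; apply/mapP; have [g fg gf] := injF_bij finj.
by exists (g y); rewrite ?mem_enum.
Qed.

(** A ranking that sorts the letters of a word sends them to positions that carry
    these same letters in the standard word: the two sorted rearrangements of
    one multiset coincide. *)
Lemma block_rank n I w (r : 'S_n) : w \in words n I ->
    (forall j k, r j < r k -> nth 0 w j <= nth 0 w k) ->
  forall j, block I (r j) = nth 0 w j.
Proof.
move=> ww mono j; have szw := size_words ww.
pose v := [seq nth 0 w ((r^-1)%g y) | y <- enum 'I_n].
have szv : size v = n by rewrite size_map size_enum_ord.
have vE (y : 'I_n) : nth 0 v y = nth 0 w ((r^-1)%g y).
  by rewrite (nth_map y) ?size_enum_ord // nth_ord_enum.
suff vstd : v = std_word n I.
  have := vE (r j); rewrite permK => <-.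
  by rewrite vstd (nth_map 0) ?size_iota // nth_iota.
apply: (sorted_eq leq_trans anti_leq); last 1 first.
- move: ww; rewrite mem_permutations => /(perm_trans _); apply.
  rewrite -[X in perm_eq _ X](mkseq_nth 0) szw /mkseq -val_enum_ord -map_comp.
  rewrite /v (map_comp (fun y : 'I_n => nth 0 w y)).
  apply: perm_map; apply: uniq_perm; rewrite ?(map_inj_uniq perm_inj) ?enum_uniq //.
  move=> y; rewrite mem_enum inE; apply/mapP.
  by exists (r y); rewrite ?mem_enum ?permK.
- apply/(sortedP 0) => i; rewrite szv => i1n.
  rewrite (vE (Ordinal i1n)) (vE (Ordinal (ltnW i1n))).
  by apply: mono; rewrite !permKV.
- rewrite sorted_map; apply: sub_sorted (iota_ltn_sorted 0 n) => y z /= /ltnW.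
  exact: block_mono.
Qed.

(** The inverse of a permutation that increases on blocks ranks the positions of
    its word by letter, then from left to right; conversely this ranking exists
    for every word. *)
Lemma alpha_words n I : alpha n I = size (words n I).
Proof.
pose word_of (s : 'S_n) := [seq block I ((s^-1)%g j) | j <- enum 'I_n].
rewrite /alpha cardE -(size_map word_of); apply: perm_size.
have nth_word (s : 'S_n) (j : 'I_n) : nth 0 (word_of s) j = block I ((s^-1)%g j).
  by rewrite (nth_map j) ?size_enum_ord // nth_ord_enum.
apply: uniq_perm => [||w]; last 1 first.
- apply/mapP/idP => [[s _ ->] | ww]; first exact: enum_words perm_inj.
  have szw := size_words ww.
  (* As j < n, this key compares letters first and then positions. *)
  pose key (j : 'I_n) := nth 0 w j * n + j.
  have keylt (j k : 'I_n) : (key j < key k) = (nth 0 w j < nth 0 w k) ||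
      (nth 0 w j == nth 0 w k) && (j < k).
    rewrite /key; case: (ltngtP (nth 0 w j) (nth 0 w k)) => [lt|lt|->] /=.
    - by have := leq_mul lt (leqnn n); have := ltn_ord j; lia.
    - by have := leq_mul lt (leqnn n); have := ltn_ord k; lia.
    - by rewrite ltn_add2l.
  have [j k eqk|r rE] := @rank_perm _ key.
    have := keylt j k; have := keylt k j; rewrite eqk ltnn => h1 h2.
    by apply: ord_inj; move: h1 h2; lia.
  have bE := block_rank ww (r := r).
  have {}bE j : block I (r j) = nth 0 w j.
    by apply: bE => {}j k; rewrite rE keylt; lia.
  exists (r^-1)%g; last first.
    rewrite /word_of invgK -[w](mkseq_nth 0) szw /mkseq -val_enum_ord -map_comp.
    by apply: eq_map => j /=; rewrite bE.
  rewrite mem_enum inE; apply/descents_subP => y z yz eqb.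
  have /= := rE ((r^-1)%g y) ((r^-1)%g z); rewrite keylt -!bE !permKV yz eqb.
  by rewrite ltnn eqxx.
- rewrite map_inj_in_uniq ?enum_uniq // => s t; rewrite !mem_enum !inE.
  move=> /descents_subP sI /descents_subP tI eqst.
  have order (u : 'S_n) :
      (forall y z : 'I_n, y < z -> block I y = block I z -> u y < u z) ->
      forall j k, ((u^-1)%g j < (u^-1)%g k) =
        (nth 0 (word_of u) j < nth 0 (word_of u) k) ||
        (nth 0 (word_of u) j == nth 0 (word_of u) k) && (j < k).
    move=> incr j k; rewrite !nth_word.
    have half a b : (u^-1)%g a < (u^-1)%g b ->
        (block I ((u^-1)%g a) < block I ((u^-1)%g b)) ||
        (block I ((u^-1)%g a) == block I ((u^-1)%g b)) && (a < b).
      move=> ab; have := block_mono I (ltnW ab); rewrite leq_eqVlt orbC.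
      case/orP => [-> //|/eqP e]; rewrite e eqxx /= orbC.
      by have := incr _ _ ab e; rewrite !permKV => ->.
    apply/idP/idP => [/half // | ]; apply: contraTT; rewrite -leqNgt leq_eqVlt.
    case/orP => [/eqP/val_inj/perm_inj -> | /half]; first by rewrite !ltnn andbF.
    by lia.
  by apply: invg_inj; apply: perm_order_inj => j k; rewrite !order // eqst.
- exact: words_uniq.
Qed.

(** * Periods and primitive words *)

(** The letters of a word, repeated periodically. Statements about rotations
    become statements about this function of all natural numbers. *)
Definition cyc (w : seq nat) (j : nat) : nat := nth 0 w (j %% size w).

Lemma cyc_small w j : j < size w -> cyc w j = nth 0 w j.
Proof. by move=> jn; rewrite /cyc modn_small. Qed.

Lemma cyc_size w j : cyc w (j + size w) = cyc w j.
Proof. by rewrite /cyc modnDr. Qed.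

Lemma eq_cyc w u : size w = size u -> cyc w =1 cyc u -> w = u.
Proof.
move=> eqsz eqf; apply: (@eq_from_nth _ 0) => // j jn.
by rewrite -!cyc_small ?eqf // -eqsz.
Qed.

Definition is_period (w : seq nat) (k : nat) : bool :=
  all (fun j => cyc w (j + k) == cyc w j) (iota 0 (size w)).

Lemma is_periodP w k :
  reflect (forall j, cyc w (j + k) = cyc w j) (is_period w k).
Proof.
apply: (iffP allP) => [per j | per j _]; last by rewrite per.
have [n0|n0] := posnP (size w).
  by rewrite /cyc !nth_default // n0.
have jn : j %% size w \in iota 0 (size w) by rewrite mem_iota /= add0n ltn_mod.
by have /eqP := per _ jn; rewrite /cyc modnDml modn_mod.
Qed.

Lemma ex_period w : exists k, (0 < k) && is_period w k.
Proof.
have [/size0nil->|n0] := posnP (size w); first by exists 1.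
by exists (size w); rewrite n0; apply/is_periodP => j; rewrite cyc_size.
Qed.

Definition min_period w := ex_minn (ex_period w).

Lemma min_periodP w :
  [/\ 0 < min_period w, is_period w (min_period w) &
     forall k, 0 < k -> is_period w k -> min_period w <= k].
Proof.
rewrite /min_period; case: ex_minnP => m /andP[m0 per] minm; split=> // k k0 perk.
by apply: minm; rewrite k0.
Qed.

Lemma periodM f m q : (forall j, f (j + m) = f j :> nat) ->
  forall j, f (j + q * m) = f j.
Proof.
move=> per; elim: q => [|q IHq] j; first by rewrite addn0.
by rewrite mulSn addnCA addnC per IHq.
Qed.

(** The remainder of a period modulo the least one is again a period. *)
Lemma min_period_dvd w k : is_period w k -> min_period w %| k.
Proof.
have [m0 /is_periodP perm minm] := min_periodP w => /is_periodP perk.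
rewrite /dvdn; have [//|r0] := posnP (k %% min_period w).
suff /(minm _ r0) : is_period w (k %% min_period w).
  by rewrite leqNgt ltn_mod m0.
apply/is_periodP => j; rewrite -(periodM (k %/ min_period w) perm) -addnA.
by rewrite [X in j + X]addnC -divn_eq.
Qed.

Lemma min_period_dvd_size w : min_period w %| size w.
Proof. by apply/min_period_dvd/is_periodP => j; rewrite cyc_size. Qed.

Lemma eq_min_period w u : cyc w =1 cyc u -> min_period w = min_period u.
Proof.
move=> eqf; have eqper k : is_period w k = is_period u k.
  by apply/is_periodP/is_periodP => per j; have := per j; rewrite !eqf.
have [w0 perw minw] := min_periodP w; have [u0 peru minu] := min_periodP u.
by apply/eqP; rewrite eqn_leq minw ?eqper // minu -?eqper.
Qed.

Definition primitive (w : seq nat) : bool := min_period w == size w.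

Definition repeat d (u : seq nat) : seq nat := flatten (nseq d u).

Lemma size_repeat d u : size (repeat d u) = d * size u.
Proof. by rewrite size_flatten /shape map_nseq sumn_nseq mulnC. Qed.

Lemma count_repeat a d u : count a (repeat d u) = d * count a u.
Proof. by rewrite count_flatten map_nseq sumn_nseq mulnC. Qed.

Lemma cyc_repeat d u : 0 < d -> cyc (repeat d u) =1 cyc u.
Proof.
move=> d0 j; have [n0|n0] := posnP (size u).
  by rewrite /cyc !nth_default // ?size_repeat n0 ?muln0.
rewrite /cyc size_repeat.
have <- : j %% (d * size u) %% size u = j %% size u by rewrite modn_dvdm ?dvdn_mull.
have : j %% (d * size u) < d * size u by rewrite ltn_mod muln_gt0 d0.
elim: (d) {d0} (j %% _) => [|e IHe] i //; rewrite mulSn /repeat /= nth_cat.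
case: (ltnP i (size u)) => [iu _|ui]; first by rewrite modn_small.
rewrite -{1}(subnK ui) addnC ltn_add2l => /IHe ->.
by rewrite -{2}(subnK ui) modnDr.
Qed.

Lemma repeat_root w m : 0 < size w -> m %| size w -> is_period w m ->
  repeat (size w %/ m) (take m w) = w.
Proof.
move=> n0 mn /is_periodP per; have m_le := dvdn_leq n0 mn.
have m0 := dvdn_gt0 n0 mn.
have szt : size (take m w) = m by rewrite size_takel.
apply: eq_cyc => [|j]; first by rewrite size_repeat szt divnK.
rewrite cyc_repeat ?divn_gt0 // {1}/cyc szt nth_take ?ltn_mod //.
rewrite -cyc_small; last by apply: leq_trans m_le; rewrite ltn_mod.
by rewrite {2}(divn_eq j m) addnC (periodM _ per).
Qed.

(** * Powers of words and division of I *)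

Lemma dvdn_gcd_with d I n :
  (d %| gcd_with I n) = (d %| n) && all (dvdn d) (enum_fset I).
Proof.
rewrite /gcd_with; apply/idP/idP => [dg|/andP[dn /allP dI]].
  have dvd i : i \in n |` I -> d %| i.
    by move=> iI; apply: dvdn_trans dg _; rewrite big_seq_fsetE (biggcdn_inf [`iI]).
  rewrite dvd ?fset1U1 //=; apply/allP => i iI; apply: dvd.
  by rewrite fset1Ur.
rewrite big_seq; elim/big_rec: _ => [|i g]; first exact: dvdn0.
by rewrite dvdn_gcd => /fset1UP[-> -> |/dI /= -> ->]; rewrite ?dn.
Qed.

Lemma gcd_with_gt0 I n : 0 < n -> 0 < gcd_with I n.
Proof.
move=> n0; have := dvdnn (gcd_with I n); rewrite dvdn_gcd_with => /andP[gn _].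
exact: dvdn_gt0 n0 gn.
Qed.

Lemma mem_fset_div I d i : 0 < d -> (i \in fset_div I d) = (d * i \in I).
Proof.
move=> d0; rewrite /fset_div; apply/imfsetP/idP => [[k /=]|diI].
  by rewrite !inE => /andP[kI dk ->]; rewrite mulnC divnK.
by exists (d * i); rewrite ?inE /= ?diI ?dvdn_mulr // mulKn.
Qed.

(** Counting the elements of I up to y, rather than naming blocks by their end
    points, makes the letters of I and of I / d agree without relabelling. *)
Lemma block_fset_div I d y : 0 < d -> all (dvdn d) (enum_fset I) ->
  block (fset_div I d) (y %/ d) = block I y.
Proof.
move=> d0 /allP dI; rewrite /block.
have permI : perm_eq [seq d * i | i <- enum_fset (fset_div I d)] (enum_fset I).
  apply: uniq_perm => [||k].
  - rewrite map_inj_uniq ?fset_uniq // => a b /eqP.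
    by rewrite eqn_pmul2l // => /eqP.
  - exact: fset_uniq.
  - apply/mapP/idP => [[i]|kI]; first by rewrite mem_fset_div // => ? ->.
    have dk := dI _ kI; exists (k %/ d); rewrite ?mem_fset_div // mulnC divnK //.
rewrite -(seq.permP permI) count_map; apply: eq_count => i /=.
by rewrite leq_divRL // mulnC.
Qed.

(** Each position of the short word corresponds to d consecutive positions of the
    long one. *)
Lemma std_word_div I n d : d %| gcd_with I n -> 0 < n ->
  perm_eq (std_word n I) (repeat d (std_word (n %/ d) (fset_div I d))).
Proof.
rewrite dvdn_gcd_with => /andP[dn dI] n0; have d0 := dvdn_gt0 n0 dn.
apply/seq.permP => a; rewrite count_repeat /std_word !count_map.
rewrite -{1}(divnK dn); elim: (n %/ d) => [|m IHm]; first by rewrite muln0.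
rewrite -{2}addn1 iotaD count_cat mulnDr -IHm mulSn addnC iotaD count_cat.
congr (_ + _); rewrite (@eq_in_count _ _ (fun=> a (block (fset_div I d) m))).
  by rewrite /= addn0; case: (a _); rewrite ?count_predT ?size_iota ?count_pred0; lia.
move=> y; rewrite mem_iota => /andP[ly uy] /=; rewrite -(block_fset_div y d0 dI).
suff -> : y %/ d = m by [].
apply/eqP; rewrite eqn_leq -ltnS ltn_divLR // leq_divRL // ly andbT.
by rewrite mulSn addnC.
Qed.

Lemma repeat_words I n d u : 0 < n -> d %| gcd_with I n ->
  (repeat d u \in words n I) = (u \in words (n %/ d) (fset_div I d)).
Proof.
move=> n0 dg; have /seq.permP := std_word_div dg n0; rewrite !mem_permutations => pE.
have d0 : 0 < d by apply: dvdn_gt0 dg; apply: gcd_with_gt0.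
apply/seq.permP/seq.permP => eqc a; have := eqc a; rewrite pE !count_repeat.
  by move/eqP; rewrite eqn_pmul2l // => /eqP.
by move->.
Qed.

(** An element i of I is the number of letters smaller than the block of i, and
    every count of letters in a power is divisible by the exponent. *)
Lemma dvd_gcd_with_root (I : {fset nat}) n m w :
    0 < n -> (forall i, i \in I -> i < n) ->
  w \in words n I -> m %| n -> is_period w m -> n %/ m %| gcd_with I n.
Proof.
move=> n0 I_lt ww mn per; rewrite dvdn_gcd_with dvdn_div //=; apply/allP => i iI.
have szw := size_words ww.
have lti := I_lt i iI.
have -> : i = count (fun c => c < block I i) w.
  move: ww; rewrite mem_permutations => /seq.permP ->.
  rewrite count_map (@eq_count _ _ (fun y => y < i)); last first.
    by move=> y /=; rewrite block_lt_mem.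
  rewrite -(subnKC (ltnW lti)) iotaD count_cat.
  rewrite (@eq_in_count _ _ predT); last by move=> y; rewrite mem_iota.
  rewrite count_predT size_iota (@eq_in_count _ _ pred0) ?count_pred0 ?addn0 //.
  by move=> y; rewrite mem_iota /=; lia.
rewrite -(@repeat_root w m) ?szw // count_repeat dvdn_mulr //.
Qed.

Lemma divn_codivisor n d : 0 < n -> d %| n -> n %/ (n %/ d) = d.
Proof.
move=> n0 dn; have d0 := dvdn_gt0 n0 dn; have le := dvdn_leq n0 dn.
have e0 : 0 < n %/ d by rewrite divn_gt0.
by rewrite -{1}(divnK dn) mulKn.
Qed.

(** Words are sorted by their least period n / d; taking the root is then a
    bijection onto the primitive words of length n / d. *)
Lemma size_words_primitive I n : 0 < n -> (forall i, i \in I -> i < n) ->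
  size (words n I) =
  \sum_(d <- divisors (gcd_with I n))
     count primitive (words (n %/ d) (fset_div I d)).
Proof.
move=> n0 I_lt; have g0 := gcd_with_gt0 I n0.
have -> : size (words n I) =
    \sum_(w <- words n I)
       count (fun d => min_period w == n %/ d) (divisors (gcd_with I n)).
  rewrite -sum1_size; apply: eq_big_seq => w ww; have szw := size_words ww.
  have [m0 per _] := min_periodP w; have := min_period_dvd_size w; rewrite szw => mn.
  rewrite (@eq_in_count _ _ (pred1 (n %/ min_period w))).
    rewrite count_uniq_mem ?divisors_uniq // -dvdn_divisors //.
    by rewrite (dvd_gcd_with_root n0 I_lt ww).
  move=> d; rewrite -dvdn_divisors // dvdn_gcd_with => /andP[dn _] /=.
  by apply/eqP/eqP => ->; rewrite divn_codivisor.
have -> : forall s : seq (seq nat),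
    \sum_(w <- s) count (fun d => min_period w == n %/ d) (divisors (gcd_with I n)) =
    \sum_(d <- divisors (gcd_with I n)) count (fun w => min_period w == n %/ d) s.
  move=> s; under eq_bigr => w _ do rewrite -sum1_count big_mkcond.
  by rewrite exchange_big; apply: eq_bigr => d _; rewrite -sum1_count [RHS]big_mkcond.
apply: eq_big_seq => d; rewrite -dvdn_divisors // => dg.
have /andP[dn _] : (d %| n) && all (dvdn d) (enum_fset I) by rewrite -dvdn_gcd_with.
have d0 := dvdn_gt0 n0 dn.
rewrite -!size_filter -[RHS](size_map (repeat d)); apply/perm_size/uniq_perm => [||w].
- by rewrite filter_uniq ?words_uniq.
- rewrite map_inj_in_uniq ?filter_uniq ?words_uniq // => u v.
  rewrite !mem_filter => /andP[_ /size_words su] /andP[_ /size_words sv] eqr.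
  apply: eq_cyc => [|j]; first by rewrite su.
  by rewrite -(cyc_repeat _ d0) eqr cyc_repeat.
- rewrite mem_filter; apply/andP/mapP => [[/eqP mE ww]|[u]].
    have szw := size_words ww; have [_ per _] := min_periodP w.
    have wE : repeat d (take (n %/ d) w) = w.
      have := @repeat_root w (n %/ d); rewrite szw divn_codivisor //.
      by apply; rewrite ?dvdn_div // -mE.
    exists (take (n %/ d) w) => //; rewrite mem_filter -repeat_words // wE ww andbT.
    rewrite /primitive size_takel ?szw ?leq_div //.
    by rewrite -(eq_min_period (cyc_repeat _ d0)) wE mE.
  rewrite mem_filter => /andP[/eqP pu uw] ->; rewrite repeat_words //; split=> //.
  by rewrite (eq_min_period (cyc_repeat _ d0)) pu (size_words uw).
Qed.

(** * Orders compatible with a letter sequence *)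

(** The rule of lexicographic comparison of the tails f j, f (j + 1), ..., stated
    for keys K of the indices: compare the first letters and, if they agree, move
    on by one. The keys below are the orbit of a cycle that increases on blocks,
    with its itinerary as f, and the numerical values of the rotations of a word. *)
Definition order_key (f K : nat -> nat) : Prop :=
  (forall j k, f j < f k -> K j < K k) /\
  (forall j k, f j = f k -> (K j.+1 < K k.+1) = (K j < K k)).

(** Advance both indices to the first disagreement of the tails. *)
Lemma order_key_unique f K K' j k t : order_key f K -> order_key f K' ->
  f (j + t) <> f (k + t) -> (K j < K k) = (K' j < K' k).
Proof.
move=> [K1 K2] [K'1 K'2]; elim: t j k => [|t IHt] j k.
  rewrite !addn0 => /eqP; case: (ltngtP (f j) (f k)) => // lt _; first by rewrite K1 ?K'1.
  by rewrite (ltnNge (K j)) (ltnNge (K' j)) (ltnW (K1 _ _ lt)) (ltnW (K'1 _ _ lt)).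
have [lt|lt|e] := ltngtP (f j) (f k); first by rewrite K1 ?K'1.
  by rewrite (ltnNge (K j)) (ltnNge (K' j)) (ltnW (K1 _ _ lt)) (ltnW (K'1 _ _ lt)).
by rewrite -!addSnnS => /IHt; rewrite K2 // K'2.
Qed.

Lemma order_key_eq f K j k t : order_key f K -> K j = K k -> f (j + t) = f (k + t).
Proof.
move=> [K1 K2]; elim: t j k => [|t IHt] j k e.
all: have ef : f j = f k by case: (ltngtP (f j) (f k)) => // /K1; rewrite e ltnn.
  by rewrite !addn0.
rewrite -!addSnnS; apply: IHt; have := K2 _ _ ef; have := K2 _ _ (esym ef).
by rewrite e ltnn; case: ltngtP.
Qed.

(** If K 0 and K k were in strict order then, f having period k, K would be
    strictly monotone along 0, k, 2k, ..., and could not return to K 0 at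
    the index n k. *)
Lemma order_key_period f K n k : order_key f K -> 0 < n ->
    (forall j, K (j + n) = K j) -> (forall j, f (j + k) = f j) -> K k = K 0.
Proof.
move=> [_ K2] n0 perK perf.
have nk0 : K (0 + k * n) = K 0 by apply: periodM.
have step j : ((K (j + k) < K j) = (K k < K 0)) * ((K j < K (j + k)) = (K 0 < K k)).
  elim: j => [//|j IHj]; rewrite addSn !K2 //; exact: IHj.
case: (ltngtP (K k) (K 0)) => // lt; exfalso; move: nk0; rewrite mulnC.
- suff : forall q, 0 < q -> K (0 + q * k) < K 0
    by move/(_ _ n0)=> + e; rewrite e ltnn.
  elim=> // -[_ _|q IHq _]; first by rewrite mul1n.
  by rewrite mulSnr addnA; apply: ltn_trans (IHq isT); rewrite step.
- suff : forall q, 0 < q -> K 0 < K (0 + q * k)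
    by move/(_ _ n0)=> + e; rewrite e ltnn.
  elim=> // -[_ _|q IHq _]; first by rewrite mul1n.
  by rewrite mulSnr addnA; apply: (ltn_trans (IHq isT)); rewrite step.
Qed.

(** The number whose m digits in base N are f j, ..., f (j + m - 1). *)
Fixpoint digits_value (N : nat) (f : nat -> nat) (j m : nat) : nat :=
  if m is m'.+1 then digits_value N f j m' * N + f (j + m') else 0.

Lemma digits_valueS N f j m :
  digits_value N f j m.+1 = f j * N ^ m + digits_value N f j.+1 m.
Proof.
elim: m => [|m IHm]; first by rewrite /= expn0 !addn0 muln1.
rewrite -[LHS]/(digits_value N f j m.+1 * N + f (j + m.+1)) IHm.
by rewrite mulnDl -mulnA -expnSr -addnA -addSnnS.
Qed.

Lemma digits_value_lt N f j m : (forall i, f i < N) -> digits_value N f j m < N ^ m.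
Proof.
move=> fN; elim: m => [|m IHm] //=.
have := leq_mul IHm (leqnn N); rewrite mulSn -expnSr.
by apply: leq_trans; rewrite addnC -addSn leq_add2r fN.
Qed.

(** Numbers with n digits compare lexicographically. For the second clause, if V j
    is the value from j on, then N * V j + f j = f j * N ^ n + V (j + 1), because
    f (j + n) = f j; so V j and V (j + 1) grow together when f j is fixed. *)
Lemma digits_order_key N f n : (forall i, f i < N) -> (forall i, f (i + n) = f i) ->
  0 < n -> order_key f (digits_value N f ^~ n).
Proof.
move=> fN per n0; have N0 : 0 < N by apply: leq_ltn_trans (fN 0).
split=> j k; last first.
  move=> e; have := digits_valueS N f j n; have := digits_valueS N f k n.
  rewrite /= !per e => ek ej; rewrite -(ltn_add2l (f k * N ^ n)) -ek -ej.
  by rewrite ltn_add2r ltn_pmul2r.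
case: n n0 per => // m _ _ lt; rewrite !digits_valueS.
apply: (@leq_trans ((f j).+1 * N ^ m)).
  by rewrite mulSn addnC -addSn leq_add2r digits_value_lt.
by apply: leq_trans (leq_addr _ _); rewrite leq_mul2r lt orbT.
Qed.

(** * Cycles and primitive words *)

Section Cycles.

Variables (n : nat) (s : 'S_n.+1).

Lemma single_cycleP x :
  reflect (forall y, exists t, y = iter t s x) (s \in single_cycle n.+1).
Proof.
rewrite inE; apply: (iffP eqP) => [porbE y|orb].
  have : porbit s x \in porbits s by apply: imset_f.
  rewrite porbE inE => /eqP px; have : y \in porbit s x by rewrite px inE.
  by case/porbitP=> t ->; exists t; rewrite permX.
have px : porbit s x = [set: 'I_n.+1].
  apply/setP => y; rewrite inE; apply/porbitP; have [t ->] := orb y.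
  by exists t; rewrite permX.
rewrite -px /porbits; apply/setP => P; rewrite inE; apply/imsetP/eqP => [[y _ ->]|->].
  by apply/eqP; rewrite eq_porbit_mem px inE.
by exists x.
Qed.

Hypothesis s_cycle : s \in single_cycle n.+1.

Lemma card_porbit_cycle x : #|porbit s x| = n.+1.
Proof.
have /(single_cycleP x) orb := s_cycle.
rewrite (_ : porbit s x = setT) ?cardsT ?card_ord //.
apply/setP => y; rewrite inE; apply/porbitP; have [t ->] := orb y.
by exists t; rewrite permX.
Qed.

Lemma iter_cycle x j : iter (j + n.+1) s x = iter j s x.
Proof. by have := iter_porbit s x; rewrite card_porbit_cycle iterD => ->. Qed.

Lemma iter_cycle_inj x j k : j < n.+1 -> k < n.+1 ->
  iter j s x = iter k s x -> j = k.
Proof.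
move=> jn kn e; have := uniq_traject_porbit s x; rewrite card_porbit_cycle => u.
apply/eqP; rewrite -(nth_uniq x _ _ u) ?size_traject //.
by rewrite !nth_traject ?e.
Qed.

Lemma iter_cycle_mod x j : iter (j %% n.+1) s x = iter j s x.
Proof.
rewrite [in RHS](divn_eq j n.+1) addnC; elim: (_ %/ _) => [|q IHq].
  by rewrite addn0.
by rewrite mulSnr addnA iter_cycle.
Qed.

Lemma iter_cycle_onto x y : exists2 j, j < n.+1 & y = iter j s x.
Proof.
have /(single_cycleP x)/(_ y)[t ->] := s_cycle.
by exists (t %% n.+1); rewrite ?ltn_mod ?iter_cycle_mod.
Qed.

End Cycles.

Definition itinerary n I (s : 'S_n) (x : 'I_n) : seq nat :=
  mkseq (fun j => block I (iter j s x)) n.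

Section Itineraries.

Variables (n : nat) (I : {fset nat}) (s : 'S_n.+1).

Hypotheses (s_cycle : s \in single_cycle n.+1) (s_desc : descents s `<=` I).

Lemma size_itinerary x : size (itinerary I s x) = n.+1.
Proof. exact: size_mkseq. Qed.

Lemma cyc_itinerary x j : cyc (itinerary I s x) j = block I (iter j s x).
Proof. by rewrite /cyc size_itinerary nth_mkseq ?ltn_mod // iter_cycle_mod. Qed.

(** Monotonicity of the block number gives the first clause, and the fact that s
    increases on blocks the second. *)
Lemma itinerary_order_key x :
  order_key (cyc (itinerary I s x)) (fun j => iter j s x).
Proof.
have /descents_subP incr := s_desc.
split=> j k; rewrite !cyc_itinerary; first exact: block_lt_imp.
move=> e; rewrite !iterS; apply/idP/idP => [|lt]; last exact: incr.
apply: contraTT; rewrite -!leqNgt leq_eqVlt => /orP[/eqP/val_inj -> //|lt].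
by rewrite ltnW // incr.
Qed.

Lemma itinerary_words x : itinerary I s x \in words n.+1 I.
Proof.
have inj : injective (fun j : 'I_n.+1 => iter j s x).
  by move=> j k /iter_cycle_inj e; apply: val_inj; apply: e.
have := enum_words I inj; rewrite /itinerary /mkseq -val_enum_ord -map_comp.
by [].
Qed.

(** A period k < n of the itinerary would force s^k x = x. *)
Lemma itinerary_primitive x : primitive (itinerary I s x).
Proof.
set w := itinerary I s x; have [m0 /is_periodP per _] := min_periodP w.
have perK j : iter (j + n.+1) s x = iter j s x :> nat by rewrite iter_cycle.
have e := order_key_period (itinerary_order_key x) (ltn0Sn n) perK per.
have mn : min_period w %| n.+1 by rewrite -(size_itinerary x) min_period_dvd_size.
rewrite /primitive size_itinerary eqn_leq dvdn_leq //=.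
rewrite leqNgt; apply/negP => lt; have : min_period w = 0; last by lia.
by apply: (iter_cycle_inj s_cycle) => //; apply: ord_inj; apply: e.
Qed.

End Itineraries.

Lemma primitive_shift w j k : primitive w -> j < size w -> k < size w ->
  (forall t, cyc w (j + t) = cyc w (k + t)) -> j = k.
Proof.
wlog jk : j k / j <= k => [wl|] pr jn kn e.
  case/orP: (leq_total j k) => jk; first exact: wl.
  by apply/esym/wl => // t; rewrite e.
have : is_period w (k - j).
  apply/is_periodP => i; rewrite -(cyc_size w i) -(cyc_size w (i + _)).
  have -> : i + (k - j) + size w = k + (i + (size w - j)) by lia.
  have -> : i + size w = j + (i + (size w - j)) by lia.
  by rewrite e.
move/min_period_dvd; rewrite (eqP pr); have [|pos] := posnP (k - j); first by lia.
by move/(dvdn_leq pos); lia.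
Qed.

(** Since the itinerary is primitive, its tails are pairwise distinct, so the
    order of the orbit is forced, and with it the orbit itself. *)
Lemma itinerary_inj n I (s t : 'S_n.+1) x y :
    s \in single_cycle n.+1 -> descents s `<=` I ->
    t \in single_cycle n.+1 -> descents t `<=` I ->
  itinerary I s x = itinerary I t y -> (s, x) = (t, y).
Proof.
move=> sc sd tc td e.
have sinj : injective (fun j : 'I_n.+1 => iter j s x).
  by move=> j k /(iter_cycle_inj sc) h; apply: val_inj; apply: h.
have tinj : injective (fun j : 'I_n.+1 => iter j t y).
  by move=> j k /(iter_cycle_inj tc) h; apply: val_inj; apply: h.
have : perm sinj = perm tinj.
  apply: perm_order_inj => j k; rewrite !permE.
  have [->|njk] := eqVneq j k; first by rewrite !ltnn.
  have sK := itinerary_order_key sc sd x; have tK := itinerary_order_key tc td y.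
  rewrite -e in tK.
  have [/forallP eqf|] := boolP [forall i : 'I_n.+1,
      cyc (itinerary I s x) (j + i) == cyc (itinerary I s x) (k + i)].
    case/eqP: njk; apply: ord_inj.
    apply: primitive_shift (itinerary_primitive sc sd x) _ _ _.
    - by rewrite size_itinerary.
    - by rewrite size_itinerary.
    move=> i; have /eqP := eqf (inord (i %% n.+1)); rewrite inordK ?ltn_mod //.
    by rewrite /cyc size_itinerary !modnDmr.
  rewrite negb_forall => /existsP[i /eqP ni].
  exact: order_key_unique sK tK ni.
move=> eqp; have eqi j : iter j s x = iter j t y.
  rewrite -(iter_cycle_mod sc) -(iter_cycle_mod tc).
  have := congr1 (fun p : 'S_n.+1 => p (inord (j %% n.+1))) eqp.
  by rewrite !permE inordK ?ltn_mod.
have xy := eqi 0; rewrite /= in xy.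
congr (_, _) => //; apply/permP => z; have [j _ ->] := iter_cycle_onto sc x z.
by have := eqi j.+1; rewrite !iterS eqi.
Qed.

(** The cycle acts on the ranks of the rotations as the rotation by one letter
    acts on the rotations, and x is the rank of the word itself. *)
Lemma itinerary_onto n I w : w \in words n.+1 I -> primitive w ->
  exists (s : 'S_n.+1) x, [/\ s \in single_cycle n.+1, descents s `<=` I
                            & w = itinerary I s x].
Proof.
move=> ww pr; have szw := size_words ww; set f := cyc w.
have [N fN] : exists N, forall i, f i < N.
  exists (\max_(c <- w) c).+1 => i; rewrite ltnS.
  apply: (@leq_bigmax_seq _ w xpredT (fun c => c)) => //.
  by rewrite mem_nth // szw ltn_mod.
have perf i : f (i + n.+1) = f i by rewrite -szw; apply: cyc_size.
have key := digits_order_key fN perf (ltn0Sn n).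
pose K j := digits_value N f j n.+1.
have [] := @rank_perm n.+1 (fun j => K j) _.
  move=> j k ejk; apply: ord_inj; apply: (primitive_shift pr); rewrite ?szw //.
  by move=> t; apply: order_key_eq key ejk.
(* s maps the rank of the j-th rotation to the rank of the next one. *)
move=> r rE; pose s : 'S_n.+1 := (r^-1 * perm (@ordS_inj n.+1) * r)%g.
have perK j : K (j %% n.+1) = K j.
  have fE i k : f (i %% n.+1 + k) = f (i + k).
    by rewrite /f /cyc szw modnDml.
  suff dE m : digits_value N f (j %% n.+1) m = digits_value N f j m by apply: dE.
  by elim: m => //= m ->; rewrite fE.
have bE j : block I (r j) = f j.
  rewrite (block_rank ww (r := r)) ?/f ?cyc_small ?szw //.
  move=> {}j k; rewrite rE -!cyc_small ?szw // => lt.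
  rewrite leqNgt; apply/negP => /(proj1 key); rewrite -/(K _) -/(K _).
  by move/(ltn_trans lt); rewrite ltnn.
have sr j : s (r j) = r (ordS j) by rewrite !permM permK permE.
have iters j : iter j s (r ord0) = r (inord (j %% n.+1)).
  elim: j => [|j IHj] /=.
    by congr (r _); apply: val_inj; rewrite /= inordK ?mod0n.
  rewrite IHj sr; congr (r _); apply: val_inj; rewrite /= !inordK ?ltn_mod //.
  by rewrite -addn1 modnDml addn1.
exists s, (r ord0); split.
- apply/(single_cycleP _ (r ord0)) => y; exists (r^-1 y)%g.
  by rewrite iters modn_small ?inord_val ?permKV.
- apply/descents_subP => y z; rewrite -(permKV r y) -(permKV r z).
  move: (_ y) (_ z) => j k; rewrite !bE !sr !rE /= !perK => lt e.
  by rewrite (proj2 key).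
- apply: (@eq_from_nth _ 0); first by rewrite size_mkseq szw.
  move=> j jn; rewrite szw in jn; rewrite nth_mkseq // iters bE.
  by rewrite inordK ?ltn_mod // modn_small // /f cyc_small ?szw.
Qed.

Lemma alpha_cyc_words n I : 0 < n -> n * alpha_cyc n I = count primitive (words n I).
Proof.
case: n => // n _; pose A := [set s in single_cycle n.+1 | descents s `<=` I].
rewrite mulnC -[X in _ * X]card_ord -cardsT -cardsX cardE.
rewrite -(size_map (fun p => itinerary I p.1 p.2)) -size_filter.
apply/perm_size/uniq_perm => [||w].
- rewrite map_inj_in_uniq ?enum_uniq // => -[s x] [t y].
  rewrite !mem_enum !inE !andbT => /andP[sc sd] /andP[tc td].
  by apply: itinerary_inj => //; rewrite inE.
- by rewrite filter_uniq ?words_uniq.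
- rewrite mem_filter; apply/mapP/andP => [[[s x]]|[pr ww]].
    rewrite mem_enum in_setX => /andP[/setIdP[sc sd] _] -> /=.
    by rewrite itinerary_primitive // itinerary_words.
  have [s [x [sc sd wE]]] := itinerary_onto ww pr.
  by exists (s, x) => //; rewrite mem_enum in_setX inE sc sd inE.
Qed.

Lemma alpha_sum n I : 0 < n -> (forall i, i \in I -> i < n) ->
  alpha n I = \sum_(d <- divisors (gcd_with I n))
                (n %/ d) * alpha_cyc (n %/ d) (fset_div I d).
Proof.
move=> n0 I_lt; rewrite alpha_words size_words_primitive //.
apply: eq_big_seq => d; rewrite -dvdn_divisors ?gcd_with_gt0 // dvdn_gcd_with.
case/andP=> dn _; have d0 := dvdn_gt0 n0 dn; have dle := dvdn_leq n0 dn.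
by rewrite alpha_cyc_words // divn_gt0.
Qed.

Local Open Scope ring_scope.

(** * Moebius inversion *)

Lemma moebius_mul_prime p d : prime p -> (0 < d)%N -> ~~ (p %| d)%N ->
  moebius (p * d) = - moebius d.
Proof.
move=> pp d0 npd; have p0 := prime_gt0 pp.
have logn_pd q : q \in primes d -> logn q (p * d) = logn q d.
  move=> qd; rewrite lognM // logn_prime // (_ : (q == p) = false) //.
  by apply: contraNF npd => /eqP<-; move: qd; rewrite mem_primes => /and3P[].
have pE : perm_eq (primes (p * d)) (p :: primes d).
  apply: uniq_perm; rewrite ?primes_uniq //=.
    by rewrite primes_uniq mem_primes (negbTE npd) !andbF.
  by move=> q; rewrite primesM // primes_prime // !inE.
rewrite /moebius (perm_all _ pE) (perm_size pE) /= lognM // logn_prime // eqxx.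
rewrite (_ : logn p d = 0%N); last by rewrite lognE (negbTE npd) !andbF.
rewrite (@eq_in_all _ _ (fun q => logn q d == 1%N)) => [|q qd]; last first.
  by rewrite logn_pd.
by rewrite addn0 /=; case: ifP => _; rewrite ?oppr0 // exprS mulN1r.
Qed.

Lemma moebius_square p d : prime p -> (0 < d)%N -> (p ^ 2 %| d)%N -> moebius d = 0.
Proof.
move=> pp d0; rewrite pfactor_dvdn // => le2; rewrite /moebius ifF //.
apply/negP => /allP/(_ p); rewrite mem_primes pp d0 /=.
have pd : (p %| d)%N by rewrite -[p]expn1 pfactor_dvdn // ltnW.
by move=> /(_ pd) /eqP e; rewrite e in le2.
Qed.

(** For a prime p dividing n, the divisors of n divisible by the square of p
    contribute 0, and the terms of d and p * d cancel when p does not divide d. *)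
Lemma sum_moebius n : (0 < n)%N -> \sum_(d <- divisors n) moebius d = (n == 1%N)%:R.
Proof.
move=> n0; have [->|n1] := eqVneq n 1%N; first by rewrite big_seq1.
have pp : prime (pdiv n) by rewrite pdiv_prime // ltn_neqAle eq_sym n1.
have pn := pdiv_dvd n; set p := pdiv n in pp pn.
have p0 := prime_gt0 pp.
rewrite (bigID (fun d => p %| d)%N) /= (bigID (fun d => p ^ 2 %| d)%N) /=.
rewrite big1_seq ?add0r; last first.
  move=> d /andP[/andP[_ p2d]]; rewrite -dvdn_divisors // => dn.
  by apply: moebius_square p2d => //; apply: dvdn_gt0 dn.
rewrite -big_filter.
have pE : perm_eq [seq d <- divisors n | (p %| d) && ~~ (p ^ 2 %| d)]%N
    [seq (p * d)%N | d <- [seq d <- divisors n | ~~ (p %| d)%N]].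
  apply: uniq_perm; rewrite ?filter_uniq ?divisors_uniq //.
    rewrite map_inj_uniq ?filter_uniq ?divisors_uniq // => a b /eqP.
    by rewrite eqn_pmul2l // => /eqP.
  move=> d; rewrite mem_filter -dvdn_divisors //; apply/idP/mapP.
    case/andP=> /andP[/dvdnP[e ->] np2] edn; exists e; last by rewrite mulnC.
    rewrite mem_filter -dvdn_divisors // (dvdn_trans _ edn) ?dvdn_mulr // andbT.
    by apply: contraNN np2 => pe; rewrite expnS expn1 dvdn_pmul2r.
  case=> e; rewrite mem_filter -dvdn_divisors // => /andP[npe en ->].
  rewrite dvdn_mulr // expnS expn1 dvdn_pmul2l // npe /=.
  by rewrite Gauss_dvd ?pn // prime_coprime.
rewrite (perm_big _ pE) big_map big_filter -big_split /= big1_seq // => d /andP[npd].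
rewrite -dvdn_divisors // => dn.
by rewrite moebius_mul_prime ?addNr //; apply: dvdn_gt0 dn.
Qed.

Lemma divisors_mul_perm g d : (0 < g)%N -> (d %| g)%N ->
  perm_eq [seq (d * e)%N | e <- divisors (g %/ d)] [seq k <- divisors g | (d %| k)%N].
Proof.
move=> g0 dg; have d0 := dvdn_gt0 g0 dg; have dle := dvdn_leq g0 dg.
have e0 : (0 < g %/ d)%N by rewrite divn_gt0.
apply: uniq_perm; rewrite ?filter_uniq ?divisors_uniq //.
  by rewrite map_inj_uniq ?divisors_uniq // => a b /eqP; rewrite eqn_pmul2l // => /eqP.
move=> k; rewrite mem_filter -dvdn_divisors //; apply/mapP/andP.
  move=> [e]; rewrite -dvdn_divisors // => eg ->; split; first exact: dvdn_mulr.
  by rewrite -(divnK dg) mulnC dvdn_pmul2r.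
case=> /dvdnP[e ->]; rewrite -{1}(divnK dg) dvdn_pmul2r // => eg.
by exists e; rewrite -?dvdn_divisors // mulnC.
Qed.

Lemma moebius_inversion g (A C : nat -> int) : (0 < g)%N ->
    (forall d, (d %| g)%N -> A d = \sum_(e <- divisors (g %/ d)) C (d * e)%N) ->
  \sum_(d <- divisors g) moebius d * A d = C 1%N.
Proof.
move=> g0 AE.
transitivity (\sum_(d <- divisors g) \sum_(k <- divisors g | (d %| k)%N) moebius d * C k).
  apply: eq_big_seq => d; rewrite -dvdn_divisors // => dg.
  rewrite AE // -mulr_sumr; congr (_ * _).
  by rewrite -[RHS]big_filter -(perm_big _ (divisors_mul_perm g0 dg)) big_map.
rewrite (exchange_big_dep xpredT) //=.
transitivity (\sum_(k <- divisors g) C k * (k == 1%N)%:R).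
  apply: eq_big_seq => k; rewrite -dvdn_divisors // => kg.
  rewrite -sum_moebius ?(dvdn_gt0 g0 kg) // mulr_sumr -big_filter.
  have k0 := dvdn_gt0 g0 kg.
  have pE : perm_eq [seq d <- divisors g | (d %| k)%N] (divisors k).
    apply: uniq_perm; rewrite ?filter_uniq ?divisors_uniq // => d.
    rewrite mem_filter -!dvdn_divisors //; case: (boolP (d %| k)%N) => //= dk.
    exact: dvdn_trans dk kg.
  by rewrite (perm_big _ pE); apply: eq_bigr => d _; rewrite mulrC.
rewrite (bigD1_seq 1%N) ?divisors_uniq -?dvdn_divisors //= mulr1.
by rewrite big1 ?addr0 // => k /negbTE->; rewrite mulr0.
Qed.

(** * Cycles counted by inversion *)

Lemma gcd_with_div I n d : (0 < n)%N -> (d %| gcd_with I n)%N ->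
  gcd_with (fset_div I d) (n %/ d) = (gcd_with I n %/ d)%N.
Proof.
move=> n0 dg; have g0 := gcd_with_gt0 I n0; have d0 := dvdn_gt0 g0 dg.
have /andP[dn /allP dI] : (d %| n)%N && all (dvdn d) (enum_fset I).
  by rewrite -dvdn_gcd_with.
have dvdE e : (e %| gcd_with (fset_div I d) (n %/ d) = (e %| gcd_with I n %/ d))%N.
  rewrite -[RHS](dvdn_pmul2r d0) (divnK dg) !dvdn_gcd_with.
  rewrite -[in RHS](divnK dn) dvdn_pmul2r //; congr (_ && _).
  apply/allP/allP => dvd i iI.
    have di := dI _ iI; rewrite -(divnK di) dvdn_pmul2r //; apply: dvd.
    by rewrite /= mem_fset_div // mulnC divnK.
  have := dvd (d * i)%N; rewrite mulnC dvdn_pmul2r //; apply.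
  by rewrite mulnC -mem_fset_div.
by apply/eqP; rewrite eqn_dvd dvdE dvdnn -dvdE dvdnn.
Qed.

Lemma fset_divM I d e : (0 < d)%N -> (0 < e)%N ->
  fset_div (fset_div I d) e = fset_div I (d * e).
Proof.
move=> d0 e0; apply/fsetP => i.
by rewrite !mem_fset_div ?muln_gt0 ?d0 ?e0 // mulnA.
Qed.

Lemma fset_div1 I : fset_div I 1 = I.
Proof. by apply/fsetP => i; rewrite mem_fset_div // mul1n. Qed.

Lemma alpha_cyc_sum n I : (0 < n)%N -> (forall i, i \in I -> (i < n)%N) ->
  (n * alpha_cyc n I)%:R = \sum_(d <- divisors (gcd_with I n))
     moebius d * (alpha (n %/ d) (fset_div I d))%:R :> int.
Proof.
move=> n0 I_lt; have g0 := gcd_with_gt0 I n0.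
rewrite (moebius_inversion g0 (A := fun d => (alpha (n %/ d) (fset_div I d))%:R)
  (C := fun k => (n %/ k * alpha_cyc (n %/ k) (fset_div I k))%:R)) ?divn1 ?fset_div1 //.
move=> d dg; have d0 := dvdn_gt0 g0 dg.
have /andP[dn _] : (d %| n)%N && all (dvdn d) (enum_fset I) by rewrite -dvdn_gcd_with.
have dle := dvdn_leq n0 dn; have e0 : (0 < n %/ d)%N by rewrite divn_gt0.
rewrite alpha_sum // => [|i]; last first.
  by rewrite mem_fset_div // => /I_lt; rewrite ltn_divRL // mulnC.
rewrite gcd_with_div // natr_sum; apply: eq_big_seq => e.
have gd0 : (0 < gcd_with I n %/ d)%N by rewrite divn_gt0 // dvdn_leq.
rewrite -dvdn_divisors // => eg; have e1 := dvdn_gt0 gd0 eg.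
by rewrite divnMA fset_divM.
Qed.

(** * Alternating sums over subsets *)

(** The sum of (-1) ^ (|s| - |J|) F J over the subsets J of s, written as an
    iterated difference: each element of s in turn is put into J, or left out
    with a minus sign. *)
Fixpoint altsum (s : seq nat) (F : {fset nat} -> int) : int :=
  if s is a :: s' then altsum s' (fun J => F (a |` J)) - altsum s' F else F fset0.

Lemma eq_altsum s F G : (forall J, {subset J <= s} -> F J = G J) ->
  altsum s F = altsum s G.
Proof.
elim: s F G => [|a s IHs] F G eqFG /=.
  by apply: eqFG => x; rewrite inE.
congr (_ - _); apply: IHs => J Js; apply: eqFG => x; rewrite !inE.
  by case/orP=> [->|/Js ->]; rewrite ?orbT.
by move/Js->; rewrite orbT.
Qed.

Lemma altsum_sum (T : Type) (r : seq T) (P : pred T) F s :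
  altsum s (fun J => \sum_(i <- r | P i) F i J) = \sum_(i <- r | P i) altsum s (F i).
Proof. by elim: s F => [|a s IHs] F //=; rewrite !IHs -sumrB. Qed.

Lemma altsum0 s : altsum s (fun=> 0) = 0.
Proof. by elim: s => //= a s ->; rewrite subrr. Qed.

Lemma altsumZ c s F : altsum s (fun J => c * F J) = c * altsum s F.
Proof. by elim: s F => //= a s IHs F; rewrite !IHs mulrBr. Qed.

(** Inclusion-exclusion for a single set D. The set K collects the elements that
    the recursion has already put into J. *)
Lemma altsum_subset (D K : {fset nat}) s : uniq s -> ~~ has (mem K) s ->
  altsum s (fun J => (D `<=` J `|` K)%:R) =
  (all (mem D) s && all (fun x => (x \in s) || (x \in K)) (enum_fset D))%:R.
Proof.
elim: s K => [|a s IHs] K /=.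
  by move=> _ _; rewrite fset0U; congr (nat_of_bool _)%:R; apply/fsubsetP/allP.
case/andP=> as_ us; rewrite negb_or => /andP[aK sK].
rewrite (@eq_altsum _ _ (fun J => (D `<=` J `|` (a |` K))%:R)); last first.
  by move=> J _; rewrite fsetUCA fsetUA.
rewrite !IHs //; last first.
  apply: contraNN sK => /hasP[x xs]; rewrite /= !inE => /orP[/eqP xa|xK].
    by rewrite -xa xs in as_.
  by apply/hasP; exists x.
rewrite (@eq_all _ (fun x => (x \in s) || (x \in a |` K))
                   (fun x => (x \in a :: s) || (x \in K))); last first.
  by move=> x; rewrite !inE orbCA orbA.
have [aD|aD] := boolP (a \in D).
  rewrite [X in _ - X](_ : _ = 0) ?subr0 //.
  rewrite (_ : all _ (enum_fset D) = false) ?andbF //.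
  by apply/allP => /(_ _ aD); rewrite (negbTE as_) (negbTE aK).
rewrite (@eq_in_all _ _ (fun x => (x \in s) || (x \in K))) ?subrr //.
by move=> x xD; rewrite inE; case: eqP aD => // <-; rewrite xD.
Qed.

Lemma altsum_card (T : finType) (A : {set T}) (D : T -> {fset nat}) s I :
    uniq s -> s =i I ->
  (#|[set x in A | D x == I]|)%:R =
    altsum s (fun J => (#|[set x in A | D x `<=` J]|)%:R).
Proof.
move=> us sI.
have cardE (P : pred T) : (#|[set x in A | P x]|)%:R = \sum_(x in A) (P x)%:R :> int.
  rewrite -sum1_card natr_sum [RHS]big_mkcond [LHS]big_mkcond /=.
  by apply: eq_bigr => x _; rewrite inE; case: (x \in A); case: (P x).
rewrite cardE; under eq_altsum do rewrite cardE.
rewrite altsum_sum; apply: eq_bigr => x _.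
under eq_altsum do rewrite -[X in _ `<=` X]fsetU0.
rewrite altsum_subset //; last by apply/hasPn.
rewrite eqEfsubset andbC; congr (nat_of_bool (_ && _))%:R.
  apply/fsubsetP/allP => sub y; first by rewrite sI => /sub.
  by rewrite -sI => /sub.
apply/fsubsetP/allP => sub y /sub; rewrite /= inE orbF sI //.
Qed.

Lemma fset_divU1 a J d : (0 < d)%N -> (d %| a)%N ->
  fset_div (a |` J) d = (a %/ d)%N |` fset_div J d.
Proof.
move=> d0 da; apply/fsetP => i; rewrite !inE !mem_fset_div // !inE.
by rewrite -[in LHS](divnK da) mulnC eqn_pmul2r.
Qed.

Lemma all_fsetU1 (P : pred nat) a (J : {fset nat}) :
  all P (enum_fset (a |` J)) = P a && all P (enum_fset J).
Proof.
apply/allP/andP => [h|[Pa /allP PJ] x].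
  by split; [apply: h; rewrite fset1U1 | apply/allP => x xJ; apply: h; rewrite fset1Ur].
by case/fset1UP=> [->|/PJ].
Qed.

(** An element a of s that d does not divide makes the summand vanish once it is in
    J, so only the branch without a survives, with its sign; an element that d
    divides is carried over to J / d. *)
Lemma altsum_div d s G : (0 < d)%N ->
  altsum s (fun J => if all (dvdn d) (enum_fset J) then G (fset_div J d) else 0) =
  (-1) ^+ (count (fun i => ~~ (d %| i)%N) s) *
    altsum [seq (i %/ d)%N | i <- s & (d %| i)%N] G.
Proof.
move=> d0; elim: s G => [|a s IHs] G /=.
  rewrite mul1r (_ : fset_div _ _ = fset0) //.
  by apply/fsetP => i; rewrite mem_fset_div.
rewrite IHs; under eq_altsum do rewrite all_fsetU1.
have [da|nda] /= := boolP (d %| a)%N.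
  under eq_altsum do rewrite fset_divU1 //.
  by rewrite (IHs (fun J => G ((a %/ d)%N |` J))) -mulrBr.
by rewrite altsum0 sub0r exprS mulN1r mulNr.
Qed.

Lemma fset_div_seq I d : (0 < d)%N ->
  let s := [seq (i %/ d)%N | i <- enum_fset I & (d %| i)%N] in
  uniq s /\ s =i fset_div I d.
Proof.
move=> d0 /=; split.
  rewrite map_inj_in_uniq ?filter_uniq ?fset_uniq // => a b.
  by rewrite !mem_filter => /andP[da _] /andP[db _] e; rewrite -(divnK da) e divnK.
move=> i; rewrite mem_fset_div //; apply/mapP/idP => [[k]|iI].
  by rewrite mem_filter => /andP[dk kI] ->; rewrite mulnC divnK.
by exists (d * i)%N; rewrite ?mulKn // mem_filter dvdn_mulr.
Qed.

Lemma card_fset_div I d : (0 < d)%N ->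
  (#|` I| - #|` fset_div I d|)%N = count (fun i => ~~ (d %| i)%N) (enum_fset I).
Proof.
move=> d0; have [us sI] := fset_div_seq I d0.
have -> : #|` fset_div I d| = count (dvdn d) (enum_fset I).
  rewrite -size_filter -(size_map (fun i => i %/ d)%N).
  by apply/perm_size/uniq_perm => [||x]; rewrite ?fset_uniq ?sI.
by rewrite -[#|` I|]/(size (enum_fset I)) -(count_predC (dvdn d)) addKn.
Qed.

Lemma altsum_divisors n I F (G : nat -> {fset nat} -> int) : (0 < n)%N ->
    (forall J, J `<=` I ->
       F J = \sum_(d <- divisors (gcd_with J n)) G d (fset_div J d)) ->
  altsum (enum_fset I) F =
    \sum_(d <- divisors n) (-1) ^+ (#|` I| - #|` fset_div I d|) *
      altsum [seq (i %/ d)%N | i <- enum_fset I & (d %| i)%N] (G d).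
Proof.
move=> n0 FE.
rewrite (@eq_altsum _ _ (fun J => \sum_(d <- divisors n)
    if all (dvdn d) (enum_fset J) then G d (fset_div J d) else 0)); last first.
  move=> J JI; rewrite FE; last by apply/fsubsetP => x /JI.
  rewrite -big_mkcond -big_filter; apply/perm_big/uniq_perm => [||d].
  - exact: divisors_uniq.
  - by rewrite filter_uniq ?divisors_uniq.
  by rewrite mem_filter -!dvdn_divisors ?gcd_with_gt0 // dvdn_gcd_with andbC.
rewrite altsum_sum; apply: eq_big_seq => d; rewrite -dvdn_divisors // => dn.
have d0 := dvdn_gt0 n0 dn.
by rewrite altsum_div // card_fset_div.
Qed.

Lemma beta_altsum n I s : uniq s -> s =i I ->
  (beta n I)%:R = altsum s (fun J => (alpha n J)%:R).
Proof.
move=> us sI.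
have setTE (P : pred 'S_n) : [set x in [set: 'S_n] | P x] = [set x | P x].
  by apply/setP => x; rewrite !inE.
rewrite /beta -setTE (altsum_card _ _ us sI).
by apply: eq_altsum => J _; rewrite setTE.
Qed.

Lemma beta_cyc_altsum n I s : uniq s -> s =i I ->
  (beta_cyc n I)%:R = altsum s (fun J => (alpha_cyc n J)%:R).
Proof. exact: altsum_card. Qed.

Lemma beta_cyc_sum n I : (0 < n)%N -> (forall i, i \in I -> (i < n)%N) ->
  (n * beta_cyc n I)%:R = \sum_(d <- divisors n)
     moebius d * (-1) ^+ (#|` I| - #|` fset_div I d|) *
     (beta (n %/ d) (fset_div I d))%:R :> int.
Proof.
move=> n0 I_lt; rewrite natrM (beta_cyc_altsum _ (fset_uniq I) (fun=> erefl)) -altsumZ.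
rewrite (@altsum_divisors n I _
  (fun d J => moebius d * (alpha (n %/ d) J)%:R)) // => [|J /fsubsetP JI].
  apply: eq_big_seq => d; rewrite -dvdn_divisors // => dn.
  have [us sI] := fset_div_seq I (dvdn_gt0 n0 dn).
  by rewrite altsumZ -(beta_altsum _ us sI) mulrA [_ * moebius d]mulrC.
by rewrite -natrM alpha_cyc_sum // => i /JI/I_lt.
Qed.

Lemma beta_sum n I : (0 < n)%N -> (forall i, i \in I -> (i < n)%N) ->
  (beta n I)%:R = \sum_(d <- divisors n)
     (-1) ^+ (#|` I| - #|` fset_div I d|) * (n %/ d)%:R *
     (beta_cyc (n %/ d) (fset_div I d))%:R :> int.
Proof.
move=> n0 I_lt; rewrite (beta_altsum _ (fset_uniq I) (fun=> erefl)).
rewrite (@altsum_divisors n I _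
  (fun d J => (n %/ d)%:R * (alpha_cyc (n %/ d) J)%:R)) // => [|J /fsubsetP JI].
  apply: eq_big_seq => d; rewrite -dvdn_divisors // => dn.
  have [us sI] := fset_div_seq I (dvdn_gt0 n0 dn).
  by rewrite altsumZ -(beta_cyc_altsum _ us sI) mulrA.
rewrite alpha_sum // => [|i /JI/I_lt //].
by rewrite natr_sum; apply: eq_bigr => d _; rewrite natrM.
Qed.

Theorem theorem3p1 (n : nat) (I : {fset nat}) (n_ge1 : (1 <= n)%N)
    (I_sub : forall i : nat, i \in I -> (1 <= i <= n.-1)%N) :
  [/\ (alpha n I =
       \sum_(d <- divisors (gcd_with I n))
          (n %/ d) * alpha_cyc (n %/ d) (fset_div I d))%N,
      (alpha_cyc n I)%:R =
        n%:R^-1 * \sum_(d <- divisors (gcd_with I n))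
          (moebius d)%:~R * (alpha (n %/ d) (fset_div I d))%:R :> rat,
      (beta_cyc n I)%:R =
        n%:R^-1 * \sum_(d <- divisors n)
          (moebius d)%:~R * (-1) ^+ (#|` I| - #|` fset_div I d|) *
          (beta (n %/ d) (fset_div I d))%:R :> rat
    & (beta n I)%:R =
        \sum_(d <- divisors n)
          (-1) ^+ (#|` I| - #|` fset_div I d|) * (n %/ d)%:R *
          (beta_cyc (n %/ d) (fset_div I d))%:R :> int].
Proof.
have I_lt i : i \in I -> (i < n)%N by move/I_sub; lia.
have divide (a : nat) (z : int) : (n * a)%:R = z -> a%:R = n%:R^-1 * z%:~R :> rat.
  move=> <-; rewrite natrM rmorphM /= !rmorph_nat mulKf // pnatr_eq0; lia.
split; [exact: alpha_sum | | | exact: beta_sum].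
  rewrite (divide _ _ (alpha_cyc_sum n_ge1 I_lt)) rmorph_sum; congr (_ * _).
  by apply: eq_bigr => d _; rewrite rmorphM /= rmorph_nat.
rewrite (divide _ _ (beta_cyc_sum n_ge1 I_lt)) rmorph_sum; congr (_ * _).
by apply: eq_bigr => d _; rewrite !rmorphM /= rmorphXn /= rmorphN1 rmorph_nat.
Qed.
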